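(* Let $(C_n)_{n\in\mathbb{N}}$ be a sequence in $\mathcal{C}^3_{\rm c}$ and let $C\in\mathcal{C}^3_{\rm c}$ be absolutely continuous; let $c_{13},c_{23}$ denote the densities of the marginal copulas $C_{13},C_{23}$ of $C$. Suppose there exist $p_{13},p_{23},p_{123}\in(1,\infty)$ with $$\|c_{13}\|_{p_{13}}<\infty,\qquad\|c_{23}\|_{p_{23}}<\infty,\qquad\|c_{13}\,c_{23}\|_{p_{123}}<\infty.$$ Then $D_1(C_n,C)\to0$ implies $D_1(\psi(C_n),\psi(C))\to0$.
   Context: $\mathbb{I}=[0,1]$, $\lambda^k$ Lebesgue measure ($\lambda=\lambda^1$). Points of $\mathbb{I}^3$ are written $(\mathbf{u},v)$, $\mathbf{u}=(u_1,u_2)$. $C_{13}(u_1,v)=C(u_1,1,v)$, $C_{23}(u_2,v)=C(1,u_2,v)$. $\|c_{13}\|_p$, $\|c_{23}\|_p$ are $L^p(\lambda^2)$ norms on $\mathbb{I}^2$, and $\|c_{13}c_{23}\|_p$ is the $L^p(\lambda^3)$ norm of $(s_1,s_2,t)\mapsto c_{13}(s_1,t)c_{23}(s_2,t)$ on $\mathbb{I}^3$. For a three-dimensional copula $C$, $K_C$ is (a version of) the regular conditional distribution of $(U_1,U_2)$ given $U_3=v$, $(U_1,U_2,U_3)\sim C$; $F_{1|3}(u_1|t)=K_C(t,[0,u_1]\times\mathbb{I})$, $F_{2|3}(u_2|t)=K_C(t,\mathbb{I}\times[0,u_2])$. $\mathcal{C}^3_{\rm c}$ is the set of three-dimensional copulas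 for which $F_{1|3}(\cdot|t)$, $F_{2|3}(\cdot|t)$ are continuous for $\lambda$-a.e. $t$; for such $C$, for a.e. $t$ the conditional copula $C^t_{12;3}$ is the unique bivariate copula with $K_C(t,[\mathbf{0},\mathbf{u}])=C^t_{12;3}(F_{1|3}(u_1|t),F_{2|3}(u_2|t))$. Partial copula $C_p(\mathbf{s})=\int_{\mathbb{I}}C^t_{12;3}(\mathbf{s})\,d\lambda(t)$; partial vine copula $\psi(C)(\mathbf{u},v)=\int_{[0,v]}C_p(F_{1|3}(u_1|t),F_{2|3}(u_2|t))\,d\lambda(t)$. $D_1(C_1,C_2)=\int_{\mathbb{I}^2}\int_{\mathbb{I}}|K_{C_1}(v,[\mathbf{0},\mathbf{u}])-K_{C_2}(v,[\mathbf{0},\mathbf{u}])|\,d\lambda(v)\,d\lambda^2(\mathbf{u})$. *)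

(* Defs.v *)
From HB Require Import structures.
From mathcomp Require Import all_boot all_order all_algebra.
From mathcomp Require Import all_classical all_reals all_analysis.

Set Implicit Arguments.
Unset Strict Implicit.
Unset Printing Implicit Defensive.

Import Order.TTheory GRing.Theory Num.Theory.
Import numFieldNormedType.Exports.

Local Open Scope classical_set_scope.
Local Open Scope ring_scope.

Section copula_defs.
Variable R : realType.

Definition I01 : set R := `[0%R, 1%R].

Notation lam := (@lebesgue_measure R).
Definition lam2 := (lam \x lam)%E.
Definition lam3 := (lam2 \x lam)%E.

Definition is_copula2 (D : R -> R -> R) : Prop :=
  [/\ (forall u, I01 u -> D u 0 = 0 /\ D 0 u = 0),
      (forall u, I01 u -> D u 1 = u /\ D 1 u = u) &
      (forall u1 u2 v1 v2, I01 u1 -> I01 u2 -> I01 v1 -> I01 v2 ->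
         u1 <= u2 -> v1 <= v2 ->
         0 <= D u2 v2 - D u2 v1 - D u1 v2 + D u1 v1)].

Definition is_copula3 (C : R -> R -> R -> R) : Prop :=
  [/\ (forall x y, I01 x -> I01 y -> C 0 x y = 0 /\ C x 0 y = 0 /\ C x y 0 = 0),
      (forall x, I01 x -> C x 1 1 = x /\ C 1 x 1 = x /\ C 1 1 x = x) &
      (forall a1 b1 a2 b2 a3 b3, I01 a1 -> I01 b1 -> I01 a2 -> I01 b2 ->
         I01 a3 -> I01 b3 -> a1 <= b1 -> a2 <= b2 -> a3 <= b3 ->
         0 <= C b1 b2 b3 - C a1 b2 b3 - C b1 a2 b3 - C b1 b2 a3
              + C a1 a2 b3 + C a1 b2 a3 + C b1 a2 a3 - C a1 a2 a3)].

Definition C13 (C : R -> R -> R -> R) (u1 v : R) : R := C u1 1 v.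
Definition C23 (C : R -> R -> R -> R) (u2 v : R) : R := C 1 u2 v.

(** K is (a version of) the regular conditional distribution of (U1,U2)
    given U3 = v, for (U1,U2,U3) ~ C, i.e. a probability kernel with
    C(u1,u2,v) = int_[0,v] K(t,[0,u1]x[0,u2]) dlambda(t). *)
Definition is_rcd (C : R -> R -> R -> R) (K : R.-pker R ~> (R * R)%type) : Prop :=
  forall u1 u2 v, I01 u1 -> I01 u2 -> I01 v ->
    ((C u1 u2 v)%:E = \int[lam]_(t in `[0%R, v]) K t (`[0%R, u1] `*` `[0%R, u2]))%E.

Definition F13 (K : R.-pker R ~> (R * R)%type) (t u1 : R) : R :=
  fine (K t (`[0%R, u1] `*` I01)).
Definition F23 (K : R.-pker R ~> (R * R)%type) (t u2 : R) : R :=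
  fine (K t (I01 `*` `[0%R, u2])).

(** membership in C^3_c (for the version K of the kernel): for lambda-a.e.
    t in I, F_{1|3}(.|t) and F_{2|3}(.|t) are continuous *)
Definition cond_cont (K : R.-pker R ~> (R * R)%type) : Prop :=
  lam.-negligible [set t | I01 t /\
     ~ (continuous (F13 K t) /\ continuous (F23 K t))].

Definition is_cond_copula (K : R.-pker R ~> (R * R)%type) (t : R)
    (D : R -> R -> R) : Prop :=
  is_copula2 D /\
  forall u1 u2, I01 u1 -> I01 u2 ->
    fine (K t (`[0%R, u1] `*` `[0%R, u2])) = D (F13 K t u1) (F23 K t u2).

(** conditional copula C^t_{12;3}: the (for a.e. t unique) bivariate copula
    with the property above; the independence copula where none exists
    (a null set of t for C in C^3_c). *)
Definition cond_copula (K : R.-pker R ~> (R * R)%type) (t : R) : R -> R -> R :=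
  match pselect (exists D, is_cond_copula K t D) with
  | left H => proj1_sig (cid H)
  | right _ => fun s1 s2 => s1 * s2
  end.

Definition partial_copula (K : R.-pker R ~> (R * R)%type) (s1 s2 : R) : R :=
  fine (\int[lam]_(t in I01) (cond_copula K t s1 s2)%:E)%E.

Definition psi (K : R.-pker R ~> (R * R)%type) (u1 u2 v : R) : R :=
  fine (\int[lam]_(t in `[0%R, v])
          (partial_copula K (F13 K t u1) (F23 K t u2))%:E)%E.

Definition D1 (K1 K2 : R.-pker R ~> (R * R)%type) : \bar R :=
  (\int[lam2]_(u in I01 `*` I01) \int[lam]_(v in I01)
     `| K1 v (`[0%R, u.1] `*` `[0%R, u.2]) - K2 v (`[0%R, u.1] `*` `[0%R, u.2]) |)%E.

Definition abs_cont3 (C : R -> R -> R -> R) : Prop :=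
  exists c : (R * R) * R -> R,
    [/\ measurable_fun setT c, (forall x, 0 <= c x) &
        forall u1 u2 v, I01 u1 -> I01 u2 -> I01 v ->
          ((C u1 u2 v)%:E =
             \int[lam3]_(x in (`[0%R, u1] `*` `[0%R, u2]) `*` `[0%R, v]) (c x)%:E)%E].

Definition is_density2 (D : R -> R -> R) (d : R * R -> R) : Prop :=
  [/\ measurable_fun setT d, (forall x, 0 <= d x) &
      forall u v, I01 u -> I01 v ->
        ((D u v)%:E = \int[lam2]_(x in `[0%R, u] `*` `[0%R, v]) (d x)%:E)%E].

Definition Lp_norm2 (p : R) (f : R * R -> R) : \bar R :=
  Lnorm lam2 p%:E (fun x => ((f \_ (I01 `*` I01)) x)%:E).
Definition Lp_norm3 (p : R) (f : (R * R) * R -> R) : \bar R :=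
  Lnorm lam3 p%:E (fun x => ((f \_ ((I01 `*` I01) `*` I01)) x)%:E).

End copula_defs.

(* Main.v *)
Require Import Defs.
From HB Require Import structures.
From mathcomp Require Import all_boot all_order all_algebra.
From mathcomp Require Import all_classical all_reals all_analysis.
From mathcomp Require Import measurable_realfun lra ring.

Set Implicit Arguments.
Unset Strict Implicit.
Unset Printing Implicit Defensive.

Import Order.TTheory GRing.Theory Num.Theory.
Import numFieldNormedType.Exports.
Import HBNNSimple.
Local Open Scope classical_set_scope.
Local Open Scope ring_scope.

(** The conditional copula at [t] is within [|F13 u1 - s1| + |F23 u2 - s2|] of the
    conditional distribution function at [u] when evaluated at [s], so it is governed
    by values of the conditional distribution functions on a countable dense set of [u].
    Convergence in [D1] makes these values converge in [L^1], uniformly in [u], because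
    the [L^1] distance is Lipschitz in [u].  Minimising the error over the first [m]
    points of the dense set and integrating over [t] gives pointwise, hence (by the
    Lipschitz property) uniform, convergence of the partial copulas; substituting the
    converging margins gives the theorem.  Measurability of the conditional copula in
    [t] is not needed: [f <= g + h] with [h] measurable can be integrated for the
    lower integral. *)

(** * Upper bounds for integrals of functions not known to be measurable *)

Lemma le_integral_nomeas d (T : measurableType d) (R : realType)
    (mu : {measure set T -> \bar R}) (D : set T) (f g : T -> \bar R) :
  (forall x, D x -> (0 <= f x)%E) -> (forall x, D x -> (f x <= g x)%E) ->
  (\int[mu]_(x in D) f x <= \int[mu]_(x in D) g x)%E.
Proof.
move=> f0 fg.
have g0 x : D x -> (0 <= g x)%E by move=> Dx; apply: le_trans (fg _ Dx); exact: f0.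
rewrite ge0_integralE// ge0_integralE//.
(* The integral is a supremum over simple minorants, and every simple minorant of [f] on [D] is one
   of [g]. *)
apply: ge_ereal_sup => _ [phi phif <-]; apply: ereal_sup_ubound; exists phi => //= x.
apply: (le_trans (phif x)); rewrite !patchE; case: ifPn => // xD.
by apply: fg; rewrite inE in xD.
Qed.

(* Lower integrals are superadditive only, but adding a measurable summand is
   exact: truncate a simple minorant of [f] by subtracting [h]. *)
Lemma le_integral_add_nomeas d (T : measurableType d) (R : realType)
    (mu : {measure set T -> \bar R}) (D : set T) (f g h : T -> R) :
  measurable D -> measurable_fun D h ->
  (forall x, D x -> 0 <= f x) -> (forall x, D x -> 0 <= g x) ->
  (forall x, D x -> 0 <= h x) -> (forall x, D x -> f x <= g x + h x) ->
  (\int[mu]_(x in D) (f x)%:E <=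
   \int[mu]_(x in D) (g x)%:E + \int[mu]_(x in D) (h x)%:E)%E.
Proof.
move=> mD mh f0 g0 h0 fgh.
rewrite [leLHS]ge0_integralE; last by move=> x Dx; rewrite lee_fin f0.
apply: ge_ereal_sup => _ [phi phif <-].
have phi_out x : ~ D x -> phi x = 0.
  move=> Dx; apply/le_anti/andP; split; last exact: fun_ge0.
  by have := phif x; rewrite patchE memNset // lee_fin.
have phiD x : D x -> phi x <= f x.
  by move=> Dx; have := phif x; rewrite patchE mem_set // lee_fin.
have -> : sintegral mu phi = (\int[mu]_(x in D) (phi x)%:E)%E.
  rewrite -integralT_nnsfun [RHS]integral_mkcond; apply: eq_integral => x _ /=.
  by rewrite patchE; case: ifPn => //; rewrite notin_setE => /phi_out ->.
apply: (@le_trans _ _ (\int[mu]_(x in D) ((Num.max (phi x - h x) 0)%:E + (h x)%:E))%E).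
  apply: le_integral_nomeas => x Dx; first by rewrite lee_fin fun_ge0.
  by rewrite -EFinD lee_fin -lerBlDr le_max lexx.
have mphi : measurable_fun D phi by exact: measurable_funTS.
rewrite (@ge0_integralD _ _ _ mu D mD) //; last first.
- exact/measurable_EFinP.
- by apply/measurable_EFinP; apply: measurable_maxr => //; exact: measurable_funB.
- by move=> x Dx; rewrite lee_fin le_max lexx orbT.
rewrite leeD2r //; apply: le_integral_nomeas => x Dx; first by rewrite lee_fin le_max lexx orbT.
by rewrite lee_fin ge_max g0 // lerBlDr (le_trans (phiD _ Dx)) // fgh.
Qed.

(** Adding to [h] the indicator of a measurable null set containing [N] makes the inequality hold
    everywhere on [D], because [f] is at most 1; the indicator integrates to 0. *)
Lemma ae_le_integral_add_nomeas d (T : measurableType d) (R : realType)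
    (mu : {measure set T -> \bar R}) (D N : set T) (f g h : T -> R) :
  measurable D -> measurable_fun D h -> mu.-negligible N ->
  (forall x, D x -> 0 <= f x <= 1) -> (forall x, D x -> 0 <= g x) ->
  (forall x, D x -> 0 <= h x) -> (forall x, D x -> ~ N x -> f x <= g x + h x) ->
  (\int[mu]_(x in D) (f x)%:E <=
   \int[mu]_(x in D) (g x)%:E + \int[mu]_(x in D) (h x)%:E)%E.
Proof.
move=> mD mh [A [mA A0 NA]] f01 g0 h0 fgh.
have mA1 : measurable_fun D (\1_A : T -> R) by exact: measurable_funTS.
have mhA : measurable_fun D (fun x => h x + \1_A x).
  exact: measurable_funD.
have := @le_integral_add_nomeas _ T R mu D f g (fun x => h x + \1_A x) mD mhA.
move=> H; apply: (le_trans (H _ _ _ _)) => //.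
- by move=> x /f01/andP[].
- by move=> x Dx; rewrite addr_ge0 // h0.
- move=> x Dx; have [/= xA|xA] := pselect (A x).
    rewrite indicE mem_set //= addrA; have /andP[_ /le_trans] := f01 _ Dx; apply.
    by rewrite lerDr addr_ge0 // ?g0 ?h0.
  by rewrite indicE memNset //= addr0 fgh // => /NA.
rewrite leeD2l //.
under eq_integral do rewrite EFinD.
rewrite (@ge0_integralD _ _ _ mu D mD) //; last first.
- exact/measurable_EFinP.
- exact/measurable_EFinP.
rewrite integral_indic // (_ : mu (A `&` D) = 0%E) ?adde0 //.
apply/le_anti; rewrite measure_ge0 andbT -A0.
by apply: le_measure; rewrite ?inE //; exact: measurableI.
Qed.

(** * The unit interval, and functions determined by their primitives *)

Lemma I01P (R : realType) (x : R) : I01 x <-> 0 <= x <= 1.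
Proof. by rewrite /I01 /= in_itv. Qed.

Lemma I01_0 (R : realType) : I01 (0 : R).
Proof. by apply/I01P; rewrite lexx ler01. Qed.

Lemma I01_1 (R : realType) : I01 (1 : R).
Proof. by apply/I01P; rewrite lexx ler01. Qed.

Lemma measurable_I01 (R : realType) : measurable (@I01 R).
Proof. exact: measurable_itv. Qed.

Lemma lebesgue_I01 (R : realType) : lebesgue_measure (@I01 R) = 1%E.
Proof. by rewrite /I01 lebesgue_measure_itv /= lte_fin ltr01 oppr0 adde0. Qed.

Lemma lebesgue_I01_lty (R : realType) : (lebesgue_measure (@I01 R) < +oo)%E.
Proof. by rewrite lebesgue_I01 ltry. Qed.

Lemma integrable_I01 (R : realType) (f : R -> R) :
  measurable_fun [set: R] f -> (forall t, 0 <= f t <= 1) ->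
  (@lebesgue_measure R).-integrable (@I01 R) (EFin \o f).
Proof.
move=> mf f01; apply: measurable_bounded_integrable.
- exact: measurable_I01.
- exact: lebesgue_I01_lty.
- exact: measurable_funTS.
- exists 1; split; first exact: num_real.
  move=> x x1 y _ /=; have /andP[y0 y1] := f01 y.
  by rewrite ger0_norm // (le_trans y1) // ltW.
Qed.

(** The fundamental theorem of calculus is applied to primitives starting at minus infinity, whereas
    kernels are specified by integrals over [[0, v]]; this translates one into the other. *)
Lemma primitive_restrict_I01 (R : realType) (f : R -> R) (x : R) :
  (\int[lebesgue_measure]_(t in `]-oo, x]) (f \_ (@I01 R)) t)%R =
  if x < 0 then 0 else (\int[lebesgue_measure]_(t in `[0%R, Num.min x 1]) f t)%R.
Proof.
rewrite /Rintegral.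
have -> : (fun t => ((f \_ (@I01 R)) t)%:E) = (EFin \o f) \_ (@I01 R) by rewrite restrict_EFin.
rewrite -integral_mkcondr; case: ltP => x0.
  rewrite (_ : _ `&` _ = set0) ?integral_set0 //.
  by rewrite -subset0 => t /= []; rewrite /I01 /= !in_itv /=; lra.
congr (fine (integral _ _ _)); apply/seteqP; split => t /=.
  by rewrite /I01 /= !in_itv /= le_min => -[-> /andP[-> ->]].
by rewrite /I01 /= !in_itv /= le_min => /andP[-> /andP[-> ->]].
Qed.

(** The restrictions of [f] and [g] to [I01] have the same primitive on the whole line, and each
    restriction is almost everywhere the derivative of its primitive. *)
Lemma ae_eq_of_primitive (R : realType) (f g : R -> R) :
  measurable_fun [set: R] f -> measurable_fun [set: R] g ->
  (forall t, 0 <= f t <= 1) -> (forall t, 0 <= g t <= 1) ->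
  (forall v, I01 v -> \int[lebesgue_measure]_(t in `[0%R, v]) (f t)%:E =
                      \int[lebesgue_measure]_(t in `[0%R, v]) (g t)%:E)%E ->
  (@lebesgue_measure R).-negligible [set t | I01 t /\ f t <> g t].
Proof.
move=> mf mg f01 g01 fg.
have aux (h : R -> R) : measurable_fun [set: R] h -> (forall t, 0 <= h t <= 1) ->
    let F x := (\int[lebesgue_measure]_(t in [set` `]-oo, x]]) (h \_ (@I01 R)) t)%R in
    {ae lebesgue_measure, forall x, derivable F x 1 /\ derive1 F x = (h \_ (@I01 R)) x}.
  move=> mh h01; apply: FTC1Ny.
    move=> y; apply: (@integrableS _ _ _ _ setT) => //.
    rewrite -restrict_EFin -integrable_mkcond; last exact: measurable_I01.
    exact: integrable_I01.
  apply: integrable_locally; first exact: measurable_I01.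
  exact: integrable_I01.
have /= af := aux _ mf f01; have /= ag := aux _ mg g01.
have FG : (fun x => \int[lebesgue_measure]_(t in [set` `]-oo, x]]) (f \_ (@I01 R)) t)%R =
          (fun x => \int[lebesgue_measure]_(t in [set` `]-oo, x]]) (g \_ (@I01 R)) t)%R.
  apply/funext => x; rewrite !primitive_restrict_I01; case: ltP => // x0.
  rewrite /Rintegral fg //; apply/I01P.
  by rewrite le_min x0 ler01 ge_min lexx orbT.
move: af; rewrite FG => af.
rewrite /negligible; have := negligibleU af ag.
apply: negligibleS => t [It ft]; apply: contrapT => /not_orP[].
move=> /contrapT[_ H1] /contrapT[_ H2]; apply: ft.
by move: H1; rewrite H2 !patchE mem_set.
Qed.

(** * Bivariate copulas: monotonicity and Lipschitz bounds *)

Section copula2.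
Variables (R : realType) (D : R -> R -> R).
Hypothesis D2 : is_copula2 D.

(** The rectangle over [[s1, s2]] and [[0, t]] gives the lower bound, the one over [[s1, s2]] and
    [[t, 1]] the upper bound, once the boundary values are inserted. *)
Lemma copula2_incrl s1 s2 t : I01 s1 -> I01 s2 -> I01 t -> s1 <= s2 ->
  0 <= D s2 t - D s1 t <= s2 - s1.
Proof.
case: D2 => D0 D1 Dincr Is1 Is2 It s12.
have I0 := I01_0 R.
have I1 := I01_1 R.
have [/I01P/andP[t0 t1] _] := (It, tt).
have H1 := Dincr s1 s2 0 t Is1 Is2 I0 It s12 t0.
have H2 := Dincr s1 s2 t 1 Is1 Is2 It I1 s12 t1.
have [A1 _] := D0 _ Is1; have [A2 _] := D0 _ Is2.
have [B1 _] := D1 _ Is1; have [B2 _] := D1 _ Is2.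
by lra.
Qed.

Lemma copula2_incrr t s1 s2 : I01 s1 -> I01 s2 -> I01 t -> s1 <= s2 ->
  0 <= D t s2 - D t s1 <= s2 - s1.
Proof.
case: D2 => D0 D1 Dincr Is1 Is2 It s12.
have I0 := I01_0 R.
have I1 := I01_1 R.
have [/I01P/andP[t0 t1] _] := (It, tt).
have H1 := Dincr 0 t s1 s2 I0 It Is1 Is2 t0 s12.
have H2 := Dincr t 1 s1 s2 It I1 Is1 Is2 t1 s12.
have [_ A1] := D0 _ Is1; have [_ A2] := D0 _ Is2.
have [_ B1] := D1 _ Is1; have [_ B2] := D1 _ Is2.
by lra.
Qed.

Lemma copula2_lip s1 s2 t1 t2 : I01 s1 -> I01 s2 -> I01 t1 -> I01 t2 ->
  `|D s1 s2 - D t1 t2| <= `|s1 - t1| + `|s2 - t2|.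
Proof.
move=> Is1 Is2 It1 It2; rewrite -(subrKA (D t1 s2)).
apply: (le_trans (ler_normD _ _)); apply: lerD.
  have [h|/ltW h] := leP s1 t1.
    have /andP[H1 H2] := copula2_incrl Is1 It1 Is2 h.
    by rewrite (distrC (D s1 s2)) (distrC s1) !ger0_norm // subr_ge0.
  have /andP[H1 H2] := copula2_incrl It1 Is1 Is2 h.
  by rewrite !ger0_norm // subr_ge0.
have [h|/ltW h] := leP s2 t2.
  have /andP[H1 H2] := copula2_incrr Is2 It2 It1 h.
  by rewrite (distrC (D t1 s2)) (distrC s2) !ger0_norm // subr_ge0.
have /andP[H1 H2] := copula2_incrr It2 Is2 It1 h.
by rewrite !ger0_norm // subr_ge0.
Qed.

Lemma copula2_01 s1 s2 : I01 s1 -> I01 s2 -> 0 <= D s1 s2 <= 1.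
Proof.
move=> Is1 Is2.
have I0 := I01_0 R.
have [/I01P/andP[s0 s1'] _] := (Is1, tt).
have := copula2_incrl I0 Is1 Is2 s0.
have [D0 _ _] := D2; have [_ ->] := D0 _ Is2.
by lra.
Qed.

End copula2.

Lemma prod_copula2 (R : realType) : is_copula2 (fun s1 s2 : R => s1 * s2).
Proof.
split => [u _|u _|u1 u2 v1 v2 _ _ _ _ h1 h2].
- by rewrite mulr0 mul0r.
- by rewrite mulr1 mul1r.
- by have := mulr_ge0 (_ : 0 <= u2 - u1) (_ : 0 <= v2 - v1); rewrite !subr_ge0 => /(_ h1 h2); lra.
Qed.

(** This covers every [t], including those where [cond_copula] takes its default, the product;
    bounds and Lipschitz estimates for it thus carry no exceptional set. *)
Lemma cond_copula_copula2 (R : realType) (K : R.-pker R ~> (R * R)%type) (t : R) :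
  is_copula2 (cond_copula K t).
Proof.
rewrite /cond_copula; case: pselect => [H|_]; last exact: prod_copula2.
by case: (cid H) => D [].
Qed.

(** * Conditional distribution functions as real functions *)

Section kbox.
Variables (R : realType) (K : R.-pker R ~> (R * R)%type).

Definition kbox (t u1 u2 : R) : R := fine (K t (`[0%R, u1] `*` `[0%R, u2])).

Lemma F13E t u : F13 K t u = kbox t u 1. Proof. by []. Qed.

Lemma F23E t u : F23 K t u = kbox t 1 u. Proof. by []. Qed.

Lemma measurable_box (u1 u2 : R) : measurable (`[0%R, u1] `*` `[0%R, u2] : set (R * R)).
Proof. by apply: measurableX; exact: measurable_itv. Qed.

Lemma kernel_box_le1 t u1 u2 : (K t (`[0%R, u1] `*` `[0%R, u2]) <= 1)%E.
Proof.
rewrite -(@prob_kernel _ _ _ _ _ K t); apply: le_measure; rewrite ?inE //.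
exact: measurable_box.
Qed.

Lemma kboxE t u1 u2 : (kbox t u1 u2)%:E = K t (`[0%R, u1] `*` `[0%R, u2]).
Proof.
rewrite /kbox fineK // ge0_fin_numE ?measure_ge0 //.
by rewrite (le_lt_trans (kernel_box_le1 _ _ _)) // ltry.
Qed.

Lemma measurable_kbox u1 u2 : measurable_fun [set: R] (fun t => kbox t u1 u2).
Proof.
apply: measurableT_comp; first exact: fine_measurable.
by apply: measurable_kernel; exact: measurable_box.
Qed.

Lemma kbox01 t u1 u2 : 0 <= kbox t u1 u2 <= 1.
Proof. by rewrite -!lee_fin kboxE measure_ge0 kernel_box_le1. Qed.

Lemma I01_kbox t u1 u2 : I01 (kbox t u1 u2).
Proof. by apply/I01P; exact: kbox01. Qed.

(** Inclusion-exclusion: the boxes with corners [(v1, u2)] and [(u1, v2)] meet in the box of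
    [(u1, u2)], and their union lies in the box of [(v1, v2)]. *)
Lemma kbox_incr t u1 u2 v1 v2 : u1 <= v1 -> u2 <= v2 ->
  kbox t v1 u2 + kbox t u1 v2 <= kbox t v1 v2 + kbox t u1 u2.
Proof.
move=> h1 h2; rewrite -lee_fin !EFinD !kboxE.
pose A a b : set (R * R) := `[0%R, a] `*` `[0%R, b].
have AI : A v1 u2 `&` A u1 v2 = A u1 u2.
  apply/seteqP; split => -[x y]; rewrite /A /= !in_itv /=.
    by move=> [[_ /andP[-> ->]] [/andP[-> ->] _]].
  move=> [/andP[-> x1] /andP[-> y1]]; rewrite x1 y1 /=.
  by rewrite (le_trans x1 h1) (le_trans y1 h2).
have mA a b : measurable (A a b) by exact: measurable_box.
have fA a b : K t (A a b) \is a fin_num by rewrite -kboxE.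
have -> : (K t (A v1 u2) + K t (A u1 v2) =
           K t (A v1 u2 `|` A u1 v2) + K t (A u1 u2))%E.
  have h : (K t (A v1 u2 `|` A u1 v2) =
     K t (A v1 u2) + K t (A u1 v2) - K t (A v1 u2 `&` A u1 v2))%E.
    by apply: measureUfinl => //; rewrite -ge0_fin_numE.
  by rewrite h AI subeK.
rewrite leeD2r //; apply: le_measure; rewrite ?inE //; [exact: measurableU|exact: mA|].
move=> [x y]; rewrite /A /= !in_itv /= => -[] [/andP[-> x1] /andP[-> y1]] /=.
  by rewrite x1 (le_trans y1 h2).
by rewrite y1 (le_trans x1 h1).
Qed.

Lemma kbox_le t u1 u2 v1 v2 : u1 <= v1 -> u2 <= v2 -> kbox t u1 u2 <= kbox t v1 v2.
Proof.
move=> h1 h2; rewrite -lee_fin !kboxE; apply: le_measure; rewrite ?inE //;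
  [exact: measurable_box..|].
move=> [x y] /=; rewrite !in_itv /= => -[/andP[-> x1] /andP[-> y1]] /=.
by rewrite (le_trans x1 h1) (le_trans y1 h2).
Qed.

(** One coordinate is moved at a time. By [kbox_incr] the mass of the strip swept out grows with the
    other coordinate, so it is at most the increment of the margin, where that coordinate is 1. *)
Lemma kbox_lip t u1 u2 v1 v2 : I01 u1 -> I01 u2 -> I01 v1 -> I01 v2 ->
  `|kbox t u1 u2 - kbox t v1 v2| <=
  `|F13 K t u1 - F13 K t v1| + `|F23 K t u2 - F23 K t v2|.
Proof.
move=> /I01P/andP[u10 u11] /I01P/andP[u20 u21] /I01P/andP[v10 v11] /I01P/andP[v20 v21].
rewrite !F13E !F23E -(subrKA (kbox t v1 u2)).
apply: (le_trans (ler_normD _ _)); apply: lerD.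
  have aux a b c : a <= b -> c <= 1 -> `|kbox t b c - kbox t a c| <= `|kbox t b 1 - kbox t a 1|.
    move=> ab c1; rewrite !ger0_norm ?subr_ge0 ?kbox_le //.
    by have := kbox_incr t ab c1; lra.
  have [h|/ltW h] := leP u1 v1; last exact: aux.
  by rewrite (distrC (kbox t u1 u2)) (distrC (kbox t u1 1)); exact: aux.
have aux a b c : a <= b -> c <= 1 -> `|kbox t c b - kbox t c a| <= `|kbox t 1 b - kbox t 1 a|.
  move=> ab c1; rewrite !ger0_norm ?subr_ge0 ?kbox_le //.
  by have := kbox_incr t c1 ab; lra.
have [h|/ltW h] := leP u2 v2; last exact: aux.
by rewrite (distrC (kbox t v1 u2)) (distrC (kbox t 1 u2)); exact: aux.
Qed.

End kbox.

(** * Existence of the conditional copula for almost every [t] *)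

Lemma lebesgue_itv0c (R : realType) (v : R) : I01 v ->
  lebesgue_measure (`[0%R, v]%classic : set R) = v%:E.
Proof.
move=> /I01P/andP[v0 v1]; rewrite lebesgue_measure_itv /= lte_fin.
case: ltP => [_|v0']; first by rewrite oppr0 adde0.
by congr EFin; apply/le_anti; rewrite v0 v0'.
Qed.

(** Intermediate values on [[-1, 1]], with [F (-1) = 0]. A preimage left of 0 can occur only for
    [s = 0]; then 0 itself serves, since continuity excludes a jump there. *)
Lemma continuous_cdf_surj (R : realType) (F : R -> R) (s : R) :
  continuous F -> (forall u, u < 0 -> F u = 0) -> F 1 = 1 -> I01 s ->
  exists u, I01 u /\ F u = s.
Proof.
move=> cF F0 F1 /I01P/andP[s0 s1].
have FN1 : F (-1) = 0 by rewrite F0 // ltrN10.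
have [|||c] := @IVT R F (-1) 1 s.
- by lra.
- exact: continuous_subspaceT.
- by rewrite FN1 F1 minElt maxElt ltr01 s0 s1.
rewrite in_itv /= => /andP[_ c1] Fc.
have [c0|c0] := leP 0 c; first by exists c; split => //; apply/I01P; rewrite c0 c1.
have s00 : s = 0 by rewrite -Fc F0.
exists 0; split; first exact: I01_0.
rewrite s00; apply/eqP/negPn/negP => nF0.
have e0 : 0 < `|F 0| by rewrite normr_gt0.
(* If [F 0] were nonzero, continuity with tolerance [|F 0|] would fail at [- (d / 2)], where [F]
   vanishes. *)
have := cF 0; move/cvgrPdist_lt => /(_ _ e0)[/= d d0 /(_ (- (d / 2)))].
have d2 : 0 < d / 2 by rewrite divr_gt0.
rewrite /= sub0r opprK (F0 (- _)) ?subr0 ?oppr_lt0 // gtr0_norm //.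
by move=> /(_ _)/negP; rewrite ltxx; apply => //; lra.
Qed.

Section regular_conditional_distribution.
Variables (R : realType) (K : R.-pker R ~> (R * R)%type).
Local Notation lam := (@lebesgue_measure R).

Lemma kbox_lt0l t u1 u2 : u1 < 0 -> kbox K t u1 u2 = 0.
Proof.
move=> u0; rewrite /kbox (_ : _ `*` _ = set0) ?measure0 //.
rewrite -subset0 => -[x y] /=; rewrite !in_itv /= => -[/andP[x0 x1] _].
by have := le_lt_trans (le_trans x0 x1) u0; rewrite ltxx.
Qed.

Lemma kbox_lt0r t u1 u2 : u2 < 0 -> kbox K t u1 u2 = 0.
Proof.
move=> u0; rewrite /kbox (_ : _ `*` _ = set0) ?measure0 //.
rewrite -subset0 => -[x y] /=; rewrite !in_itv /= => -[_ /andP[x0 x1]].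
by have := le_lt_trans (le_trans x0 x1) u0; rewrite ltxx.
Qed.

(* Sklar's theorem for the conditional distribution: with [q] choosing a
   preimage under each continuous margin, [kbox t (q1 s1) (q2 s2)] is the copula;
   the Lipschitz bound [kbox_lip] makes it independent of the choice. *)
Lemma exists_cond_copula t : continuous (F13 K t) -> continuous (F23 K t) ->
  kbox K t 1 1 = 1 -> exists D, is_cond_copula K t D.
Proof.
move=> c13 c23 k11.
have q1P s : exists u, I01 s -> I01 u /\ F13 K t u = s.
  have [Is|nIs] := pselect (I01 s); last by exists 0.
  have [|u ?] := @continuous_cdf_surj R (F13 K t) s c13 _ k11 Is; last by exists u.
  by move=> u u0; rewrite F13E kbox_lt0l.
have q2P s : exists u, I01 s -> I01 u /\ F23 K t u = s.
  have [Is|nIs] := pselect (I01 s); last by exists 0.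
  have [|u ?] := @continuous_cdf_surj R (F23 K t) s c23 _ k11 Is; last by exists u.
  by move=> u u0; rewrite F23E kbox_lt0r.
have [q1 {}q1P] := choice q1P; have [q2 {}q2P] := choice q2P.
have I0 := @I01_0 R; have I1 := @I01_1 R.
have kD u1 u2 s1 s2 : I01 u1 -> I01 u2 -> F13 K t u1 = s1 -> F23 K t u2 = s2 ->
    kbox K t u1 u2 = kbox K t (q1 s1) (q2 s2).
  move=> Iu1 Iu2 <- <-; apply/eqP; rewrite -subr_eq0 -normr_le0.
  have [Iq1 Fq1] := q1P _ (I01_kbox K t u1 1).
  have [Iq2 Fq2] := q2P _ (I01_kbox K t 1 u2).
  apply: (le_trans (kbox_lip K t Iu1 Iu2 _ _)) => //.
  by rewrite Fq1 Fq2 !subrr normr0 addr0.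
exists (fun s1 s2 => kbox K t (q1 s1) (q2 s2)); split; last first.
  by move=> u1 u2 Iu1 Iu2; rewrite -(kD u1 u2).
split.
- move=> u Iu.
  have [_ Q1] := q1P _ I0; have [_ Q2] := q2P _ I0.
  have [Iq1 _] := q1P _ Iu; have [Iq2 _] := q2P _ Iu.
  move: Iq1 Iq2 => /I01P/andP[_ iq1] /I01P/andP[_ iq2].
  split; apply/le_anti; rewrite (andP (kbox01 K t _ _)).1 andbT.
    by have := kbox_le K t iq1 (lexx (q2 0)); rewrite -F23E Q2.
  by have := kbox_le K t (lexx (q1 0)) iq2; rewrite -F13E Q1.
- move=> u Iu; have [Iq1 Q1] := q1P _ Iu; have [Iq2 Q2] := q2P _ Iu.
  split; first by rewrite -(kD (q1 u) 1 u 1) // -F13E.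
  by rewrite -(kD 1 (q2 u) 1 u) // -F23E.
- move=> u1 u2 v1 v2 Iu1 Iu2 Iv1 Iv2 u12 v12.
  (* A right inverse of a nondecreasing function is nondecreasing, however the preimages are
     chosen. *)
  have mono (F q : R -> R) (u v : R) : (forall s, I01 s -> I01 (q s) /\ F (q s) = s) ->
      {homo F : x y / x <= y} -> I01 u -> I01 v -> u <= v -> q u <= q v.
    move=> qP Fle Iu Iv uv; have [//|qvu] := leP (q u) (q v).
    have := Fle _ _ (ltW qvu); rewrite (qP _ Iu).2 (qP _ Iv).2 => vu.
    by move: qvu; have -> : u = v by [apply/le_anti; rewrite uv vu]; rewrite ltxx.
  have h1 : q1 u1 <= q1 u2.
    by apply: (mono (F13 K t)) => // x y xy; rewrite !F13E kbox_le.
  have h2 : q2 v1 <= q2 v2.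
    by apply: (mono (F23 K t)) => // x y xy; rewrite !F23E kbox_le.
  by have := kbox_incr K t h1 h2; lra.
Qed.

Lemma cond_copulaP t : (exists D, is_cond_copula K t D) ->
  is_cond_copula K t (cond_copula K t).
Proof. by move=> H; rewrite /cond_copula; case: pselect => // H'; case: cid. Qed.

Variable C : R -> R -> R -> R.
Hypotheses (C3 : is_copula3 C) (CK : is_rcd C K).

Lemma integral_kbox u1 u2 v : I01 u1 -> I01 u2 -> I01 v ->
  (\int[lam]_(t in `[0%R, v]) (kbox K t u1 u2)%:E = (C u1 u2 v)%:E)%E.
Proof.
by move=> Iu1 Iu2 Iv; rewrite CK //; apply: eq_integral => t _; rewrite kboxE.
Qed.

Lemma integral_F13 u : I01 u -> (\int[lam]_(t in @I01 R) (F13 K t u)%:E = u%:E)%E.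
Proof.
move=> Iu; case: C3 => _ Cm _; have [Cu _] := Cm _ Iu.
by rewrite -[in RHS]Cu -integral_kbox //; exact: I01_1.
Qed.

Lemma integral_F23 u : I01 u -> (\int[lam]_(t in @I01 R) (F23 K t u)%:E = u%:E)%E.
Proof.
move=> Iu; case: C3 => _ Cm _; have [_ [Cu _]] := Cm _ Iu.
by rewrite -[in RHS]Cu -integral_kbox //; exact: I01_1.
Qed.

(** [K t] is a probability on the whole plane; that it sits on the unit square for almost every [t]
    follows from [C 1 1 v = v] by comparing primitives with those of the constant 1. *)
Lemma kbox11_ae : lam.-negligible [set t | I01 t /\ kbox K t 1 1 <> 1].
Proof.
apply: (@ae_eq_of_primitive R (fun t => kbox K t 1 1) (cst 1)).
- exact: measurable_kbox.
- exact: measurable_cst.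
- by move=> t; exact: kbox01.
- by move=> t /=; rewrite ler01 lexx.
- move=> v Iv; rewrite integral_kbox //; [|exact: I01_1..].
  case: C3 => _ Cm _; have [_ [_ ->]] := Cm _ Iv.
  rewrite [RHS](integral_cst lam (measurable_itv `[0%R, v]) 1%:E) mul1e.
  exact/esym/lebesgue_itv0c.
Qed.

Hypothesis Kc : cond_cont K.

Lemma cond_margins_ae : lam.-negligible [set t | I01 t /\
  ~ [/\ continuous (F13 K t), continuous (F23 K t) & kbox K t 1 1 = 1]].
Proof.
apply: negligibleS (negligibleU Kc kbox11_ae) => t [It H].
have [k1|k1] := pselect (kbox K t 1 1 = 1); last by right.
by left; split => // -[c1 c2]; apply: H.
Qed.

Lemma is_cond_copula_ae :
  lam.-negligible [set t | I01 t /\ ~ is_cond_copula K t (cond_copula K t)].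
Proof.
apply: negligibleS cond_margins_ae => t [It H]; split => // -[c1 c2 k1].
by apply: H; apply: cond_copulaP; exact: exists_cond_copula.
Qed.

End regular_conditional_distribution.

(** * From convergence in [D1] to uniform convergence in [u] of the inner integrals *)

Section kernel_distance.
Variables (R : realType) (K K' : R.-pker R ~> (R * R)%type).
Local Notation lam := (@lebesgue_measure R).

Definition kdist (u1 u2 : R) : \bar R :=
  (\int[lam]_(t in @I01 R) (`|kbox K t u1 u2 - kbox K' t u1 u2|)%:E)%E.

Lemma kdist_ge0 u1 u2 : (0 <= kdist u1 u2)%E.
Proof. by apply: integral_ge0 => t _; rewrite lee_fin. Qed.

Lemma D1E : D1 K K' = (\int[@lam2 R]_(u in @I01 R `*` @I01 R) kdist u.1 u.2)%E.
Proof.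
apply: eq_integral => u _; apply: eq_integral => t _.
by rewrite -!kboxE -EFinB abse_EFin.
Qed.

End kernel_distance.

Section margins_distance.
Variables (R : realType) (K : R.-pker R ~> (R * R)%type) (C : R -> R -> R -> R).
Hypotheses (C3 : is_copula3 C) (CK : is_rcd C K).
Local Notation lam := (@lebesgue_measure R).

(** By monotonicity [k t u - k t v] has the same sign for all [t], so the absolute value can be
    taken outside the integral. *)
Lemma integral_normB_margins (k : R -> R -> R) :
  (forall u, measurable_fun [set: R] (fun t => k t u)) ->
  (forall t u, 0 <= k t u) ->
  (forall t u v, u <= v -> k t u <= k t v) ->
  (forall u, I01 u -> \int[lam]_(t in @I01 R) (k t u)%:E = u%:E)%E ->
  forall u v, I01 u -> I01 v ->
  (\int[lam]_(t in @I01 R) (`|k t u - k t v|)%:E = `|u - v|%:E)%E.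
Proof.
move=> mk k0 kle ik.
have aux u v : u <= v -> I01 u -> I01 v ->
    (\int[lam]_(t in @I01 R) (`|k t v - k t u|)%:E = `|v - u|%:E)%E.
  move=> uv Iu Iv; rewrite [in RHS]ger0_norm ?subr_ge0 //.
  apply/eqP; rewrite EFinB eq_sym sube_eq //; last by rewrite fin_num_adde_defl.
  rewrite -(ik v) // -(ik u) // -ge0_integralD //.
  - apply/eqP/eq_integral => t _.
    by rewrite -EFinD ger0_norm ?subr_ge0 ?kle // subrK.
  - exact: measurable_I01.
  - apply/measurable_EFinP; apply: measurable_funTS.
    by apply: (measurableT_comp (@normr_measurable R setT)); apply: measurable_funB; exact: mk.
  - by move=> t _; rewrite lee_fin.
  - by apply/measurable_EFinP; apply: measurable_funTS; exact: mk.
move=> u v Iu Iv; have [uv|/ltW uv] := leP v u; first exact: aux.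
by rewrite distrC -aux //; apply: eq_integral => t _; rewrite distrC.
Qed.

Lemma integral_normB_F13 u v : I01 u -> I01 v ->
  (\int[lam]_(t in @I01 R) (`|F13 K t u - F13 K t v|)%:E = `|u - v|%:E)%E.
Proof.
apply: (integral_normB_margins (k := F13 K)).
- by move=> w; exact: measurable_kbox.
- by move=> t w; have /andP[] := kbox01 K t w 1.
- by move=> t w z wz; exact: kbox_le.
- exact: (integral_F13 C3 CK).
Qed.

Lemma integral_normB_F23 u v : I01 u -> I01 v ->
  (\int[lam]_(t in @I01 R) (`|F23 K t u - F23 K t v|)%:E = `|u - v|%:E)%E.
Proof.
apply: (integral_normB_margins (k := F23 K)).
- by move=> w; exact: measurable_kbox.
- by move=> t w; have /andP[] := kbox01 K t 1 w.
- by move=> t w z wz; exact: kbox_le.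
- exact: (integral_F23 C3 CK).
Qed.

End margins_distance.

Lemma measurable_normB_kbox (R : realType) (K K' : R.-pker R ~> (R * R)%type)
    (u1 u2 v1 v2 : R) :
  measurable_fun [set: R] (fun t => `|kbox K t u1 u2 - kbox K' t v1 v2|).
Proof.
apply: (measurableT_comp (@normr_measurable R setT)).
by apply: measurable_funB; exact: measurable_kbox.
Qed.

(** The interval starts at [u], or is [[1 - d, 1]] when [u] is too close to 1. Two of them give a
    square of side [d] near a given point and inside the unit square. *)
Lemma I01_itv_near (R : realType) (d u : R) : I01 u -> 0 < d <= 1 ->
  exists a, forall v, v \in `[a, (a + d)] -> I01 v /\ `|u - v| <= d.
Proof.
move=> /I01P/andP[u0 u1] /andP[d0 d1]; have [h|h] := leP u (1 - d).
  exists u => v; rewrite in_itv /= => /andP[uv vu]; split; first by apply/I01P; lra.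
  by rewrite ler_norml; lra.
exists (1 - d) => v; rewrite in_itv /= => /andP[uv vu]; split; first by apply/I01P; lra.
by rewrite ler_norml; lra.
Qed.

Lemma lam2_square (R : realType) (a b d : R) : 0 < d ->
  (@lam2 R (`[a, (a + d)%R] `*` `[b, (b + d)%R]) = (d * d)%:E)%E.
Proof.
move=> d0; have H c : @lebesgue_measure R `[c, (c + d)%R] = d%:E.
  by rewrite lebesgue_measure_itv /= lte_fin ltrDl d0 -EFinD addrC addKr.
rewrite EFinM -{1}(H a) -(H b); apply: product_measure1E; exact: measurable_itv.
Qed.

Section kernel_distance_uniform.
Variables (R : realType) (K K' : R.-pker R ~> (R * R)%type).
Variables (C C' : R -> R -> R -> R).
Hypotheses (C3 : is_copula3 C) (CK : is_rcd C K).
Hypotheses (C'3 : is_copula3 C') (CK' : is_rcd C' K').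
Local Notation lam := (@lebesgue_measure R).

(** Moving [u] to [v] changes each conditional distribution function by at most the changes of its
    margins, which integrate to exactly [|u1 - v1| + |u2 - v2|]; the factor 2 counts the two
    kernels. *)
Lemma kdist_lip u1 u2 v1 v2 : I01 u1 -> I01 u2 -> I01 v1 -> I01 v2 ->
  (kdist K K' u1 u2 <=
   kdist K K' v1 v2 + (2 * (`|u1 - v1| + `|u2 - v2|))%:E)%E.
Proof.
move=> Iu1 Iu2 Iv1 Iv2.
pose h1 t := `|F13 K t u1 - F13 K t v1| + `|F23 K t u2 - F23 K t v2|.
pose h2 t := `|F13 K' t u1 - F13 K' t v1| + `|F23 K' t u2 - F23 K' t v2|.
have mI := @measurable_I01 R.
have ih (k : R.-pker R ~> (R * R)%type) (c : R -> R -> R -> R) :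
    is_copula3 c -> is_rcd c k ->
    (\int[lam]_(t in @I01 R) (`|F13 k t u1 - F13 k t v1| + `|F23 k t u2 - F23 k t v2|)%:E
      = (`|u1 - v1| + `|u2 - v2|)%:E)%E.
  move=> c3 ck; rewrite EFinD -(integral_normB_F13 c3 ck Iu1 Iv1).
  rewrite -(integral_normB_F23 c3 ck Iu2 Iv2) -ge0_integralD //.
  - by apply/measurable_EFinP; apply: measurable_funTS; exact: measurable_normB_kbox.
  - by apply/measurable_EFinP; apply: measurable_funTS; exact: measurable_normB_kbox.
have mh (k : R.-pker R ~> (R * R)%type) : measurable_fun [set: R]
    (fun t => `|F13 k t u1 - F13 k t v1| + `|F23 k t u2 - F23 k t v2|).
  by apply: measurable_funD; exact: measurable_normB_kbox.
have -> : (2 * (`|u1 - v1| + `|u2 - v2|))%:E =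
    (\int[lam]_(t in @I01 R) (h1 t + h2 t)%:E)%E.
  rewrite mulr_natl mulr2n EFinD -{1}(ih K C) // -(ih K' C') // -ge0_integralD //.
  - by apply/measurable_EFinP; apply: measurable_funTS; exact: mh.
  - by apply/measurable_EFinP; apply: measurable_funTS; exact: mh.
apply: le_integral_add_nomeas => //.
- by apply: measurable_funTS; apply: measurable_funD; exact: mh.
- by move=> t _; rewrite !addr_ge0.
- move=> t _.
  have L1 := kbox_lip K t Iu1 Iu2 Iv1 Iv2; have L2 := kbox_lip K' t Iu1 Iu2 Iv1 Iv2.
  have -> : kbox K t u1 u2 - kbox K' t u1 u2 = (kbox K t v1 v2 - kbox K' t v1 v2) +
     ((kbox K t u1 u2 - kbox K t v1 v2) - (kbox K' t u1 u2 - kbox K' t v1 v2)) by ring.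
  apply: (le_trans (ler_normD _ _)); rewrite lerD2l.
  by apply: (le_trans (ler_normB _ _)); exact: lerD.
Qed.

(** If [kdist] were at least [e] somewhere, it would be at least [e / 2] on a nearby square of side
    [e / 8], as the Lipschitz loss there is at most [2 * (e / 8 + e / 8)]. That square alone would
    contribute the assumed bound to [D1]. *)
Lemma kdist_small (e : R) : 0 < e <= 1 ->
  (D1 K K' < (e / 2 * (e / 8 * (e / 8)))%:E)%E ->
  forall u1 u2, I01 u1 -> I01 u2 -> (kdist K K' u1 u2 < e%:E)%E.
Proof.
move=> /andP[e0 e1] De u1 u2 Iu1 Iu2; rewrite ltNge; apply/negP => ek.
have d01 : 0 < e / 8 <= 1 by apply/andP; split; lra.
have [d0 _] := andP d01.
have [a ha] := I01_itv_near Iu1 d01; have [b hb] := I01_itv_near Iu2 d01.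
move: De; apply/negP; rewrite -leNgt D1E.
set S : set (R * R) := `[a, (a + e / 8)%R] `*` `[b, (b + e / 8)%R].
have mS : measurable S by apply: measurableX; exact: measurable_itv.
rewrite EFinM -(lam2_square a b d0) -/S -integral_cst //.
rewrite [leLHS]integral_mkcond [leRHS]integral_mkcond; apply: le_integral_nomeas.
  move=> x _; rewrite patchE; case: ifPn => // _.
  by rewrite lee_fin divr_ge0 // ltW.
move=> [x y] _; rewrite !patchE; case: ifPn => [|_]; last first.
  by case: ifPn => // _; exact: kdist_ge0.
rewrite inE => -[/= /ha[Ix nx] /hb[Iy ny]]; rewrite mem_set //=.
have := le_trans ek (kdist_lip Iu1 Iu2 Ix Iy).
have [kk|kk] := eqVneq (kdist K K' x y) +oo%E; first by rewrite kk => _; exact: leey.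
have kf : kdist K K' x y \is a fin_num by rewrite ge0_fin_numE ?kdist_ge0 // ltey.
by rewrite -(fineK kf) -EFinD !lee_fin; lra.
Qed.

End kernel_distance_uniform.

(** * Approximation tools: grids, a dense sequence and running minima *)

Lemma ge0_cvg0P (R : realType) (u : nat -> \bar R) : (forall n, (0 <= u n)%E) ->
  u @ \oo --> 0%E <-> forall e : R, 0 < e -> \forall n \near \oo, (u n < e%:E)%E.
Proof.
move=> u0; split=> [/fine_cvgP[fu /cvgrPdist_lt cu] e /cu|H].
  apply: filterS2 fu => n fn; rewrite sub0r normrN /= => h.
  by rewrite -(fineK fn) lte_fin (le_lt_trans _ h) // ler_norm.
apply/fine_cvgP; split.
  by apply: filterS (H 1 ltr01) => n h; rewrite ge0_fin_numE // (lt_trans h) ?ltry.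
apply/cvgrPdist_lt => e e0; apply: filterS (H e e0) => n h.
have fn : u n \is a fin_num by rewrite ge0_fin_numE // (lt_trans h) ?ltry.
by rewrite sub0r normrN /= ger0_norm ?fine_ge0 // -lte_fin fineK.
Qed.

(** The grid has mesh [1 / (n + 1) < d], and [u] is rounded down. The minimum with 1 keeps the grid
    point in [I01] for every [a], while the bound on [a] makes a finite grid sufficient. *)
Lemma exists_nat_ratio_near (R : realType) (d : R) : 0 < d ->
  exists n : nat, forall u : R, I01 u ->
  exists2 a : nat, (a <= n.+1)%N & `|u - Num.min (a%:R / n.+1%:R) 1| < d.
Proof.
move=> d0; exists (Num.truncn d^-1) => u /I01P/andP[u0 u1]; set n := Num.truncn _.
have n0 : (0 : R) < n.+1%:R by rewrite ltr0n.
exists (Num.truncn (u * n.+1%:R)); set a := Num.truncn _.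
  rewrite truncn_le_nat (@le_lt_trans _ _ n.+1%:R) ?ltr_nat //.
  by rewrite ler_piMl // ltW.
have dn : n.+1%:R^-1 < d.
  by rewrite invf_plt ?posrE //; exact: truncnS_gt.
have a1 : a%:R / n.+1%:R <= u.
  by rewrite ler_pdivrMr // truncn_le mulr_ge0.
have a2 : u < a%:R / n.+1%:R + n.+1%:R^-1.
  by rewrite -{2}(mul1r (n.+1%:R^-1)) -mulrDl natr1 ltr_pdivlMr // truncnS_gt.
by rewrite min_l ?(le_trans a1) // ger0_norm ?subr_ge0 // (lt_trans _ dn) // ltrBlDl.
Qed.

Lemma exists_dense_unit_square (R : realType) : exists r : nat -> R * R,
  (forall j, I01 (r j).1 /\ I01 (r j).2) /\
  forall u1 u2 d, I01 u1 -> I01 u2 -> 0 < d ->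
    exists j, `|u1 - (r j).1| < d /\ `|u2 - (r j).2| < d.
Proof.
pose q (a n : nat) : R := Num.min (a%:R / n.+1%:R) 1.
have Iq a n : I01 (q a n) by apply/I01P; rewrite le_min divr_ge0 // ler01 ge_min lexx orbT.
(* Codes that decode to no triple are sent to [(0, 0)], so that every [r j] lies in the unit
   square. *)
pose r j : R * R := if (unpickle j : option (nat * nat * nat)) is Some (a, b, n)
  then (q a n, q b n) else (0, 0).
exists r; split.
  move=> j; rewrite /r; case: unpickle => [[[a b] n]|] /=; last by split; exact: I01_0.
  by split; exact: Iq.
move=> u1 u2 d Iu1 Iu2 d0.
have [n h] := exists_nat_ratio_near d0.
have [a _ ha] := h _ Iu1; have [b _ hb] := h _ Iu2.
by exists (pickle (a, b, n)); rewrite /r pickleK.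
Qed.

Section running_min.
Variable R : realType.
Implicit Type f : nat -> R.

(** Realises a countable infimum as a limit of finite minima, which are measurable and attained at
    some index up to [m]. *)
Fixpoint running_min f (m : nat) : R :=
  if m is k.+1 then Num.min (running_min f k) (f k.+1) else f 0%N.

Lemma running_min_le f m j : (j <= m)%N -> running_min f m <= f j.
Proof.
elim: m => [|m IH] /=; first by rewrite leqn0 => /eqP ->.
rewrite leq_eqVlt ltnS => /orP[/eqP ->|/IH h]; first by rewrite ge_min lexx orbT.
by rewrite ge_min h.
Qed.

Lemma running_min_attained f m : exists2 j, (j <= m)%N & running_min f m = f j.
Proof.
elim: m => [|m [j jm IH]] /=; first by exists 0%N.
have [h|h] := leP (running_min f m) (f m.+1); last by exists m.+1.
by exists j => //; exact: leqW.
Qed.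

Lemma cvg_running_min f l : (forall j, l <= f j) ->
  (forall e, 0 < e -> exists j, f j < l + e) -> running_min f @ \oo --> l.
Proof.
move=> lf ex; apply/cvgrPdist_lt => e /ex[j fj].
exists j => // m /= jm; have h := running_min_le f jm.
have lm : l <= running_min f m by have [i _ ->] := running_min_attained f m.
by rewrite distrC ger0_norm ?subr_ge0 // ltrBlDl (le_lt_trans h).
Qed.

Lemma measurable_running_min d (T : measurableType d) (F : T -> nat -> R) m :
  (forall j, measurable_fun [set: T] (fun t => F t j)) ->
  measurable_fun [set: T] (fun t => running_min (F t) m).
Proof.
move=> mF; elim: m => [|m IH] /=; first exact: mF.
exact: measurable_minr.
Qed.

End running_min.

(** * Bounds and Lipschitz property of the partial copula *)

Lemma integral_cst_I01 (R : realType) (c : R) :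
  (\int[@lebesgue_measure R]_(t in @I01 R) c%:E = c%:E)%E.
Proof.
rewrite (integral_cst (@lebesgue_measure R) (@measurable_I01 R) c%:E) -[RHS]mule1.
by congr (_ * _)%E; exact: lebesgue_I01.
Qed.

Lemma integral_dist_le (R : realType) (f g h : R -> R) (N : set R) :
  (forall t, I01 t -> 0 <= f t <= 1) -> (forall t, I01 t -> 0 <= g t <= 1) ->
  measurable_fun (@I01 R) h -> (forall t, I01 t -> 0 <= h t) ->
  (@lebesgue_measure R).-negligible N ->
  (forall t, I01 t -> ~ N t -> `|f t - g t| <= h t) ->
  ((`|fine (\int[@lebesgue_measure R]_(t in @I01 R) (f t)%:E)%E -
      fine (\int[@lebesgue_measure R]_(t in @I01 R) (g t)%:E)%E|)%:E <=
   \int[@lebesgue_measure R]_(t in @I01 R) (h t)%:E)%E.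
Proof.
move=> f01 g01 mh h0 nN fgh.
have mI := @measurable_I01 R.
have fin (k : R -> R) : (forall t, I01 t -> 0 <= k t <= 1) ->
    (\int[@lebesgue_measure R]_(t in @I01 R) (k t)%:E)%E \is a fin_num.
  move=> k01; rewrite ge0_fin_numE; last first.
    by apply: integral_ge0 => t /k01/andP[? _]; rewrite lee_fin.
  apply: (@le_lt_trans _ _ (\int[@lebesgue_measure R]_(t in @I01 R) (cst 1%:E t))%E).
    by apply: le_integral_nomeas => t /k01/andP[? ?]; rewrite lee_fin.
  by rewrite integral_cst // mul1e; exact: lebesgue_I01_lty.
have Hfg : (\int[@lebesgue_measure R]_(t in @I01 R) (f t)%:E <=
    \int[@lebesgue_measure R]_(t in @I01 R) (g t)%:E +
    \int[@lebesgue_measure R]_(t in @I01 R) (h t)%:E)%E.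
  apply: (@ae_le_integral_add_nomeas _ _ R (@lebesgue_measure R) (@I01 R) N f g h) => // t It.
    by have /andP[] := g01 _ It.
  by move=> nt; rewrite -lerBlDl (le_trans _ (fgh _ It nt)) // ler_norm.
have Hgf : (\int[@lebesgue_measure R]_(t in @I01 R) (g t)%:E <=
    \int[@lebesgue_measure R]_(t in @I01 R) (f t)%:E +
    \int[@lebesgue_measure R]_(t in @I01 R) (h t)%:E)%E.
  apply: (@ae_le_integral_add_nomeas _ _ R (@lebesgue_measure R) (@I01 R) N g f h) => // t It.
    by have /andP[] := f01 _ It.
  by move=> nt; rewrite -lerBlDl (le_trans _ (fgh _ It nt)) // distrC ler_norm.
move: Hfg Hgf; rewrite -(fineK (fin _ f01)) -(fineK (fin _ g01)).
have [->|hoo] := eqVneq (\int[@lebesgue_measure R]_(t in @I01 R) (h t)%:E)%E +oo%E.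
  by move=> _ _; rewrite leey.
have hf : (\int[@lebesgue_measure R]_(t in @I01 R) (h t)%:E)%E \is a fin_num.
  rewrite ge0_fin_numE ?ltey //.
  by apply: integral_ge0 => t It; rewrite lee_fin h0.
by rewrite -(fineK hf) -!EFinD !lee_fin /= => H1 H2; rewrite ler_norml; lra.
Qed.

Section partial_copula.
Variables (R : realType) (K : R.-pker R ~> (R * R)%type).
Local Notation lam := (@lebesgue_measure R).

Lemma partial_copula_lip s1 s2 t1 t2 : I01 s1 -> I01 s2 -> I01 t1 -> I01 t2 ->
  `|partial_copula K s1 s2 - partial_copula K t1 t2| <= `|s1 - t1| + `|s2 - t2|.
Proof.
move=> Is1 Is2 It1 It2; rewrite -lee_fin.
have := @integral_dist_le R (fun t => cond_copula K t s1 s2)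
  (fun t => cond_copula K t t1 t2) (cst (`|s1 - t1| + `|s2 - t2|)) set0.
rewrite integral_cst_I01; apply => //.
- by move=> t _; apply: copula2_01 => //; exact: cond_copula_copula2.
- by move=> t _; apply: copula2_01 => //; exact: cond_copula_copula2.
- by move=> t _ /=; rewrite addr_ge0.
- exact: negligible_set0.
- by move=> t _ _; apply: copula2_lip => //; exact: cond_copula_copula2.
Qed.

Lemma partial_copula01 s1 s2 : I01 s1 -> I01 s2 -> 0 <= partial_copula K s1 s2 <= 1.
Proof.
move=> Is1 Is2.
have c01 t := copula2_01 (cond_copula_copula2 K t) Is1 Is2.
have i0 : (0 <= \int[lam]_(t in @I01 R) (cond_copula K t s1 s2)%:E)%E.
  by apply/integral_ge0 => t _; rewrite lee_fin (andP (c01 t)).1.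
have i1 : (\int[lam]_(t in @I01 R) (cond_copula K t s1 s2)%:E <= 1)%E.
  rewrite -(integral_cst_I01 (1 : R)); apply: le_integral_nomeas => t _.
    by rewrite lee_fin (andP (c01 t)).1.
  by rewrite lee_fin (andP (c01 t)).2.
by rewrite -!lee_fin /partial_copula fineK ?i0 // ge0_fin_numE // (le_lt_trans i1) ?ltry.
Qed.

End partial_copula.

(** * Pointwise convergence of the partial copulas *)

Section partial_copula_convergence.
Variables (R : realType) (K : nat -> R.-pker R ~> (R * R)%type).
Variables (K0 : R.-pker R ~> (R * R)%type).
Variables (C : nat -> R -> R -> R -> R) (C0 : R -> R -> R -> R).
Hypotheses (C3 : forall n, is_copula3 (C n)) (C03 : is_copula3 C0).
Hypotheses (CK : forall n, is_rcd (C n) (K n)) (C0K : is_rcd C0 K0).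
Hypotheses (Kc : forall n, cond_cont (K n)) (K0c : cond_cont K0).
Hypothesis Kcvg : forall e : R, 0 < e -> \forall n \near \oo,
  forall u1 u2, I01 u1 -> I01 u2 -> (kdist (K n) K0 u1 u2 < e%:E)%E.
Local Notation lam := (@lebesgue_measure R).

(** The distance from [s] to the nearest pair of margin values of [K0] at [t] over the first [m + 1]
    points of [r]: the cost of replacing [s] by a point where the conditional copula is read off the
    kernel. *)
Let gap (s1 s2 : R) (r : nat -> R * R) (m : nat) (t : R) : R :=
  running_min (fun j => `|F13 K0 t (r j).1 - s1| + `|F23 K0 t (r j).2 - s2|) m.

Let measurable_gap s1 s2 r m : measurable_fun [set: R] (gap s1 s2 r m).
Proof.
apply: measurable_running_min => j; apply: measurable_funD.
  apply: (measurableT_comp (@normr_measurable R setT)).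
  by apply: measurable_funB => //; exact: measurable_kbox.
apply: (measurableT_comp (@normr_measurable R setT)).
by apply: measurable_funB => //; exact: measurable_kbox.
Qed.

Let gap_ge0 s1 s2 r m t : 0 <= gap s1 s2 r m t.
Proof.
rewrite /gap; set f := (f in running_min f).
by have [j _ ->] := running_min_attained f m; rewrite addr_ge0.
Qed.

Let gap_le2 s1 s2 r m t : I01 s1 -> I01 s2 -> gap s1 s2 r m t <= 2.
Proof.
move=> /I01P Is1 /I01P Is2; rewrite /gap; set f := (f in running_min f).
have [j _ ->] := running_min_attained f m; rewrite /f F13E F23E.
have h1 := kbox01 K0 t (r j).1 1; have h2 := kbox01 K0 t 1 (r j).2.
by rewrite -[2]/(1 + 1) lerD // ler_norml; lra.
Qed.

(** For almost every [t] the continuous margins attain [s] at some [u], and points of [r] close to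
    [u] make the gap small. Dominated convergence applies with the constant 2. *)
Let cvg_integral_gap s1 s2 (r : nat -> R * R) : I01 s1 -> I01 s2 ->
  (forall u1 u2 d, I01 u1 -> I01 u2 -> 0 < d ->
    exists j, `|u1 - (r j).1| < d /\ `|u2 - (r j).2| < d) ->
  (fun m => (\int[lam]_(t in @I01 R) (gap s1 s2 r m t)%:E)%E) @ \oo --> 0%E.
Proof.
move=> Is1 Is2 dr.
have [|||||] := @dominated_convergence _ _ R lam (@I01 R) (@measurable_I01 R)
  (fun m t => (gap s1 s2 r m t)%:E) (cst 0%E) (cst 2%:E).
- by move=> m; apply/measurable_EFinP; apply: measurable_funTS; exact: measurable_gap.
- exact: measurable_cst.
- apply: negligibleS (cond_margins_ae C03 C0K K0c) => t /= /not_implyP[It nc].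
  split=> // -[c1 c2 k1]; apply: nc.
  apply/cvg_EFin; first exact: nearW.
  apply: cvg_running_min => [j|e e0]; first by rewrite addr_ge0.
  have [u1 [Iu1 Fu1]] : exists u, I01 u /\ F13 K0 t u = s1.
    by apply: continuous_cdf_surj => // u u0; rewrite F13E kbox_lt0l.
  have [u2 [Iu2 Fu2]] : exists u, I01 u /\ F23 K0 t u = s2.
    by apply: continuous_cdf_surj => // u u0; rewrite F23E kbox_lt0r.
  have e2 : 0 < e / 2 by rewrite divr_gt0.
  have /cvgrPdist_lt/(_ _ e2)[/= d1 d10 h1] := c1 u1.
  have /cvgrPdist_lt/(_ _ e2)[/= d2 d20 h2] := c2 u2.
  have d0 : 0 < Num.min d1 d2 by rewrite lt_min d10 d20.
  have [j [r1 r2]] := dr _ _ _ Iu1 Iu2 d0; exists j.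
  rewrite lt_min in r1; rewrite lt_min in r2.
  move: r1 r2 => /andP[/h1 H1 _] /andP[_ /h2 H2]; move: H1 H2.
  rewrite Fu1 Fu2 /= add0r (distrC s1) (distrC s2) => H1 H2.
  by rewrite (splitr e) ltrD.
- apply: (@measurable_bounded_integrable _ _ R lam (cst 2)) => //.
  + exact: measurable_I01.
  + exact: lebesgue_I01_lty.
  + exists 2; split; first exact: num_real.
    by move=> x x2 y _ /=; rewrite ger0_norm // ltW.
- apply: aeW => t m It /=.
  by rewrite lee_fin ger0_norm; [exact: gap_le2|exact: gap_ge0].
- by move=> _ _; rewrite integral0.
Qed.

(** With [j] minimising the gap at [t], the path runs from the copula of [K n] at [s] to [K n] at
    [r j], then to [K0] at [r j], then to the copula of [K0] at [s]. The outer legs are Lipschitz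
    estimates; the first reaches the margins of [K n] through those of [K0]. The total is twice the
    gap plus [term j]. *)
Lemma cvg_partial_copula s1 s2 e : I01 s1 -> I01 s2 -> 0 < e ->
  \forall n \near \oo, `|partial_copula (K n) s1 s2 - partial_copula K0 s1 s2| <= e.
Proof.
move=> Is1 Is2 e0.
have [r [Ir dr]] := exists_dense_unit_square R.
have e4 : 0 < e / 4 by rewrite divr_gt0.
have [m _ /(_ m (leqnn m)) /= Hm] : \forall m \near \oo,
    (\int[lam]_(t in @I01 R) (gap s1 s2 r m t)%:E < (e / 4)%:E)%E.
  apply: (proj1 (ge0_cvg0P _)) e4; last exact: cvg_integral_gap.
  by move=> m; apply: integral_ge0 => t _; rewrite lee_fin; exact: gap_ge0.
(* [m] is fixed before [n]. Each of the [m + 1] terms integrates to at most [3 * d], hence their sum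
   to at most [e / 2]; twice the gap supplies the other half. *)
pose d := e / (6 * m.+1%:R).
have d0 : 0 < d by rewrite /d divr_gt0 // mulr_gt0 // ltr0n.
have [n0 _ Hn] := Kcvg d0; exists n0 => // n /= /Hn {}Hn.
pose D t u1 u2 := `|kbox (K n) t u1 u2 - kbox K0 t u1 u2|.
pose term (j : 'I_m.+1) t := D t (r j).1 1 + D t 1 (r j).2 + D t (r j).1 (r j).2.
(* The minimising index varies with [t], so the bound sums the terms over all indices. *)
pose h t := 2 * gap s1 s2 r m t + \sum_(j < m.+1) term j t.
have D0 t u1 u2 : 0 <= D t u1 u2 by exact: normr_ge0.
have mD u1 u2 : measurable_fun [set: R] (fun t => D t u1 u2) by exact: measurable_normB_kbox.
have term0 j t : 0 <= term j t by rewrite !addr_ge0.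
have mterm j : measurable_fun [set: R] (term j).
  by apply: measurable_funD; [apply: measurable_funD|]; exact: mD.
have mI := @measurable_I01 R.
have iD u1 u2 : I01 u1 -> I01 u2 -> (\int[lam]_(t in @I01 R) (D t u1 u2)%:E <= d%:E)%E.
  by move=> Iu1 Iu2; exact/ltW/Hn.
have iadd (f g k : R -> R) : measurable_fun [set: R] k -> (forall t, 0 <= f t) ->
    (forall t, 0 <= g t) -> (forall t, 0 <= k t) -> (forall t, f t <= g t + k t) ->
    (\int[lam]_(t in @I01 R) (f t)%:E <=
     \int[lam]_(t in @I01 R) (g t)%:E + \int[lam]_(t in @I01 R) (k t)%:E)%E.
  move=> mk f0 g0 k0 fgk; apply: (@le_integral_add_nomeas _ _ R lam) => //.
  exact: measurable_funTS.
have iterm j : (\int[lam]_(t in @I01 R) (term j t)%:E <= (3 * d)%:E)%E.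
  have [Ir1 Ir2] := Ir j.
  have -> : 3 * d = d + d + d by ring.
  rewrite 2!EFinD.
  apply: (le_trans (iadd (term j) (fun t => D t (r j).1 1 + D t 1 (r j).2)
    (fun t => D t (r j).1 (r j).2) _ _ _ _ _)) => //.
    by move=> t; rewrite addr_ge0.
  apply: leeD; last exact: iD.
  apply: (le_trans (iadd (fun t => D t (r j).1 1 + D t 1 (r j).2) (fun t => D t (r j).1 1)
    (fun t => D t 1 (r j).2) _ _ _ _ _)) => //.
    by move=> t; rewrite addr_ge0.
  by apply: leeD; apply: iD => //; exact: I01_1.
have mh : measurable_fun [set: R] h.
  apply: measurable_funD; first by apply: measurable_funM => //; exact: measurable_gap.
  exact: measurable_sum.
have ih : (\int[lam]_(t in @I01 R) (h t)%:E <= e%:E)%E.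
  have h0 t : 0 <= h t by rewrite addr_ge0 ?mulr_ge0 ?sumr_ge0 //; exact: gap_ge0.
  have -> : e = e / 4 + e / 4 + (3 * d) *+ m.+1.
    have aux (x : R) : x != 0 -> e = e / 4 + e / 4 + 3 * (e / (6 * x)) * x by move=> x0; field.
    by rewrite -(mulr_natr (3 * d) m.+1) /d; apply: aux; rewrite pnatr_eq0.
  rewrite 2!EFinD.
  apply: (le_trans (iadd h (fun t => 2 * gap s1 s2 r m t)
    (fun t => \sum_(j < m.+1) term j t) _ _ _ _ _)) => //.
  - exact: measurable_sum.
  - by move=> t; rewrite mulr_ge0 //; exact: gap_ge0.
  - by move=> t; rewrite sumr_ge0.
  apply: leeD.
    apply: (le_trans (iadd (fun t => 2 * gap s1 s2 r m t) (gap s1 s2 r m)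
      (gap s1 s2 r m) _ _ _ _ _)) => //.
    - by move=> t; rewrite mulr_ge0 //; exact: gap_ge0.
    - by move=> t; rewrite mulr_natl mulr2n.
    by apply: leeD; exact: ltW.
  under eq_integral do rewrite -sumEFin.
  rewrite ge0_integral_sum //; last first.
  - by move=> j t _; rewrite lee_fin.
  - by move=> j; apply/measurable_EFinP; apply: measurable_funTS; exact: mterm.
  rewrite -[X in _ *+ X](card_ord m.+1) -sumr_const -sumEFin.
  by apply: lee_sum => j _; exact: iterm.
rewrite /= -lee_fin; apply: (le_trans _ ih).
apply: (@integral_dist_le R _ _ h _ _ _ _ _
  (negligibleU (is_cond_copula_ae (C3 n) (CK n) (Kc n)) (is_cond_copula_ae C03 C0K K0c))).
- by move=> t _; apply: copula2_01 => //; exact: cond_copula_copula2.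
- by move=> t _; apply: copula2_01 => //; exact: cond_copula_copula2.
- exact: measurable_funTS.
- by move=> t _; rewrite addr_ge0 ?mulr_ge0 ?sumr_ge0 //; exact: gap_ge0.
move=> t It /not_orP[/not_andP[//|/contrapT[cn kn]] /not_andP[//|/contrapT[c0 k0]]].
have [j jm gj] := running_min_attained
  (fun j => `|F13 K0 t (r j).1 - s1| + `|F23 K0 t (r j).2 - s2|) m.
have [Ir1 Ir2] := Ir j.
have jm' : (j < m.+1)%N by [].
have tj : term (Ordinal jm') t <= \sum_(j < m.+1) term j t.
  by rewrite (bigD1 (Ordinal jm')) //= lerDl sumr_ge0.
apply: (@le_trans _ _ (2 * gap s1 s2 r m t + term (Ordinal jm') t)); last by rewrite lerD2l.
rewrite /gap gj /term /D /= -!F13E -!F23E.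
have IF (k : R.-pker R ~> (R * R)%type) : I01 (F13 k t (r j).1) /\ I01 (F23 k t (r j).2).
  by split; exact: I01_kbox.
have [In1 In2] := IF (K n); have [I01 I02] := IF K0.
have Ln := copula2_lip cn Is1 Is2 In1 In2.
have L0 := copula2_lip c0 I01 I02 Is1 Is2.
rewrite -(kn _ _ Ir1 Ir2) -/(kbox (K n) t _ _) in Ln.
rewrite -(k0 _ _ Ir1 Ir2) -/(kbox K0 t _ _) in L0.
have T1 := ler_distD (F13 K0 t (r j).1) s1 (F13 (K n) t (r j).1).
have T2 := ler_distD (F23 K0 t (r j).2) s2 (F23 (K n) t (r j).2).
rewrite (distrC s1 (F13 K0 _ _)) (distrC (F13 K0 _ _) (F13 (K n) _ _)) in T1.
rewrite (distrC s2 (F23 K0 _ _)) (distrC (F23 K0 _ _) (F23 (K n) _ _)) in T2.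
have T3 := ler_distD (kbox K0 t (r j).1 (r j).2) (cond_copula (K n) t s1 s2)
  (cond_copula K0 t s1 s2).
have T4 := ler_distD (kbox (K n) t (r j).1 (r j).2) (cond_copula (K n) t s1 s2)
  (kbox K0 t (r j).1 (r j).2).
by lra.
Qed.

End partial_copula_convergence.

(** * Lipschitz functions on the unit square: uniform convergence and measurability *)

Section lipschitz_unit_square.
Variable R : realType.

Definition lip_unit_square (P : R -> R -> R) := forall s1 s2 t1 t2,
  I01 s1 -> I01 s2 -> I01 t1 -> I01 t2 ->
  `|P s1 s2 - P t1 t2| <= `|s1 - t1| + `|s2 - t2|.

(** A common Lipschitz constant reduces uniform convergence to convergence on a finite grid. *)
Lemma lip_unit_square_cvg_unif (P : nat -> R -> R -> R) (P0 : R -> R -> R) :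
  (forall n, lip_unit_square (P n)) -> lip_unit_square P0 ->
  (forall s1 s2 e, I01 s1 -> I01 s2 -> 0 < e ->
    \forall n \near \oo, `|P n s1 s2 - P0 s1 s2| <= e) ->
  forall e, 0 < e -> \forall n \near \oo, forall s1 s2, I01 s1 -> I01 s2 ->
    `|P n s1 s2 - P0 s1 s2| <= e.
Proof.
move=> lP lP0 cP e e0.
(* Five errors: two coordinate moves for [P n], two for [P0], and the difference at the grid
   point. *)
have e5 : 0 < e / 5 by rewrite divr_gt0.
have [m hm] := exists_nat_ratio_near e5.
pose q (a : nat) : R := Num.min (a%:R / m.+1%:R) 1.
have Iq a : I01 (q a) by apply/I01P; rewrite le_min divr_ge0 // ler01 ge_min lexx orbT.
(* The indices run from 0 to [m + 1] inclusive, whence ['I_m.+2]. *)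
have : \forall n \near \oo, forall ab : 'I_m.+2 * 'I_m.+2,
    `|P n (q ab.1) (q ab.2) - P0 (q ab.1) (q ab.2)| <= e / 5.
  by apply: filter_forall => ab; exact: cP.
apply: filterS => n H s1 s2 Is1 Is2.
have [a am ha] := hm _ Is1; have [b bm hb] := hm _ Is2.
have am' : (a < m.+2)%N by []; have bm' : (b < m.+2)%N by [].
have := H (Ordinal am', Ordinal bm') => /= Hab.
have L1 := lP n _ _ _ _ Is1 Is2 (Iq a) (Iq b).
have L2 := lP0 _ _ _ _ (Iq a) (Iq b) Is1 Is2.
rewrite -/(q a) in ha; rewrite -/(q b) in hb.
rewrite (distrC (q a)) (distrC (q b)) in L2.
have T1 := ler_distD (P n (q a) (q b)) (P n s1 s2) (P0 s1 s2).
have T2 := ler_distD (P0 (q a) (q b)) (P n (q a) (q b)) (P0 s1 s2).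
by lra.
Qed.

(* [P] is the infimum of its countably many Lipschitz majorants centred at a
   dense set of points. *)
Lemma measurable_lip_unit_square d (T : measurableType d) (P : R -> R -> R)
    (x y : T -> R) : lip_unit_square P ->
  measurable_fun [set: T] x -> measurable_fun [set: T] y ->
  (forall t, I01 (x t)) -> (forall t, I01 (y t)) ->
  measurable_fun [set: T] (fun t => P (x t) (y t)).
Proof.
move=> lP mx my Ix Iy; have [r [Ir dr]] := exists_dense_unit_square R.
pose F t j := P (r j).1 (r j).2 + (`|x t - (r j).1| + `|y t - (r j).2|).
apply: (@measurable_fun_cvg _ _ _ _ (fun m t => running_min (F t) m)).
  move=> m; apply: measurable_running_min => j; apply: measurable_funD => //.
  apply: measurable_funD.
    apply: (measurableT_comp (@normr_measurable R setT)).
    exact: measurable_funB.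
  apply: (measurableT_comp (@normr_measurable R setT)).
  exact: measurable_funB.
move=> t _; apply: cvg_running_min => [j|e e0].
  have [Ir1 Ir2] := Ir j; have := lP _ _ _ _ (Ix t) (Iy t) Ir1 Ir2.
  by have := ler_norm (P (x t) (y t) - P (r j).1 (r j).2); rewrite /F; lra.
(* The slope of the majorant and the Lipschitz bound on [P] each cost two coordinate distances. *)
have e4 : 0 < e / 4 by rewrite divr_gt0.
have [j [j1 j2]] := dr _ _ _ (Ix t) (Iy t) e4; exists j.
have [Ir1 Ir2] := Ir j; have := lP _ _ _ _ (Ix t) (Iy t) Ir1 Ir2.
rewrite distrC.
by have := ler_norm (P (r j).1 (r j).2 - P (x t) (y t)); rewrite /F; lra.
Qed.

End lipschitz_unit_square.

(** * Kernels of partial vine copulas and the limit in [D1] *)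

Section partial_vine_copula.
Variables (R : realType) (K L : R.-pker R ~> (R * R)%type).
Hypothesis LK : is_rcd (psi K) L.

Lemma measurable_partial_copula u1 u2 : measurable_fun [set: R]
  (fun t => partial_copula K (F13 K t u1) (F23 K t u2)).
Proof.
apply: measurable_lip_unit_square.
- by move=> *; exact: partial_copula_lip.
- exact: measurable_kbox.
- exact: measurable_kbox.
- by move=> t; exact: I01_kbox.
- by move=> t; exact: I01_kbox.
Qed.

(** [L] is known only through its integrals over [[0, v]], which agree with those defining [psi K].
    The null set may depend on [u], which is harmless because [kdist] is estimated at fixed [u]. *)
Lemma kbox_psi_ae u1 u2 : I01 u1 -> I01 u2 ->
  (@lebesgue_measure R).-negligible [set t | I01 t /\
    kbox L t u1 u2 <> partial_copula K (F13 K t u1) (F23 K t u2)].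
Proof.
move=> Iu1 Iu2.
have p01 t : 0 <= partial_copula K (F13 K t u1) (F23 K t u2) <= 1.
  by apply: partial_copula01; exact: I01_kbox.
apply: ae_eq_of_primitive => //.
- exact: measurable_kbox.
- exact: measurable_partial_copula.
- by move=> t; exact: kbox01.
move=> v Iv; have := LK Iu1 Iu2 Iv; rewrite /psi fineK => [->|].
  by apply: eq_integral => t _; rewrite kboxE.
(* The [fine] in [psi] loses nothing, since the integrand takes values in [[0, 1]]. *)
apply: integrable_fin_num; first exact: measurable_itv.
apply: integrableS (integrable_I01 (measurable_partial_copula u1 u2) p01).
- exact: measurable_I01.
- exact: measurable_itv.
- by move=> t; rewrite /I01 /= !in_itv /= => /andP[-> /le_trans]; apply; have /I01P/andP[] := Iv.
Qed.

End partial_vine_copula.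

(** One [e] pays for exchanging the partial copulas at the margins of [K]; the other two pay for
    exchanging the margins inside the Lipschitz partial copula of [K0], at cost [kdist] at [(u1, 1)]
    and [(1, u2)]. *)
Lemma kdist_psi_le (R : realType) (K K0 L L0 : R.-pker R ~> (R * R)%type) (e : R) :
  is_rcd (psi K) L -> is_rcd (psi K0) L0 -> 0 <= e ->
  (forall s1 s2, I01 s1 -> I01 s2 ->
    `|partial_copula K s1 s2 - partial_copula K0 s1 s2| <= e) ->
  (forall u1 u2, I01 u1 -> I01 u2 -> (kdist K K0 u1 u2 <= e%:E)%E) ->
  forall u1 u2, I01 u1 -> I01 u2 -> (kdist L L0 u1 u2 <= (3 * e)%:E)%E.
Proof.
move=> LK LK0 e0 pe ke u1 u2 Iu1 Iu2.
pose d1 t := `|F13 K t u1 - F13 K0 t u1|; pose d2 t := `|F23 K t u2 - F23 K0 t u2|.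
have -> : 3 * e = e + e + e by ring.
rewrite 2!EFinD.
have i12 : (\int[@lebesgue_measure R]_(t in @I01 R) (e + d1 t)%:E <= e%:E + e%:E)%E.
  apply: (le_trans (@le_integral_add_nomeas _ _ R (@lebesgue_measure R) (@I01 R)
    (fun t => e + d1 t) (cst e) d1 _ _ _ _ _ _)) => //.
  - exact: measurable_I01.
  - by apply: measurable_funTS; exact: measurable_normB_kbox.
  - by move=> t _; rewrite /d1 addr_ge0.
  - by move=> t _; exact: normr_ge0.
  - by apply: leeD; [rewrite integral_cst_I01|apply: ke => //; exact: I01_1].
apply: (le_trans (@ae_le_integral_add_nomeas _ _ R (@lebesgue_measure R) (@I01 R) _
  (fun t => `|kbox L t u1 u2 - kbox L0 t u1 u2|) (fun t => e + d1 t) d2 _ _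
  (negligibleU (kbox_psi_ae LK Iu1 Iu2) (kbox_psi_ae LK0 Iu1 Iu2)) _ _ _ _)).
- exact: measurable_I01.
- by apply: measurable_funTS; exact: measurable_normB_kbox.
- move=> t _; rewrite normr_ge0 ler_norml /=.
  by have := kbox01 L t u1 u2; have := kbox01 L0 t u1 u2; lra.
- by move=> t _; rewrite /d1 addr_ge0.
- by move=> t _; exact: normr_ge0.
- move=> t It /not_orP[/not_andP[//|/contrapT ->] /not_andP[//|/contrapT ->]].
  have If (k : R.-pker R ~> (R * R)%type) : I01 (F13 k t u1) /\ I01 (F23 k t u2).
    by split; exact: I01_kbox.
  have [I1 I2] := If K; have [J1 J2] := If K0.
  have := ler_distD (partial_copula K0 (F13 K t u1) (F23 K t u2))
    (partial_copula K (F13 K t u1) (F23 K t u2)) (partial_copula K0 (F13 K0 t u1) (F23 K0 t u2)).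
  have := pe _ _ I1 I2; have := partial_copula_lip K0 I1 I2 J1 J2.
  by rewrite /d1 /d2; lra.
by apply: leeD => //; apply: ke => //; exact: I01_1.
Qed.

Lemma D1_le (R : realType) (K K' : R.-pker R ~> (R * R)%type) (e : R) : 0 <= e ->
  (forall u1 u2, I01 u1 -> I01 u2 -> (kdist K K' u1 u2 <= e%:E)%E) ->
  (D1 K K' <= e%:E)%E.
Proof.
move=> e0 ke; rewrite D1E.
have mII : measurable (@I01 R `*` @I01 R) by apply: measurableX; exact: measurable_I01.
have II1 : (@lam2 R (@I01 R `*` @I01 R) = 1)%E.
  rewrite -[RHS]mule1 -{1}(lebesgue_I01 R) -(lebesgue_I01 R).
  by apply: product_measure1E; exact: measurable_I01.
apply: (@le_trans _ _ (\int[@lam2 R]_(u in @I01 R `*` @I01 R) cst e%:E u)%E).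
  apply: le_integral_nomeas => [u _|u [? ?]]; first exact: kdist_ge0.
  exact: ke.
rewrite integral_cst // -[leRHS]mule1.
by have -> : (e%:E * 1 = e%:E * @lam2 R (@I01 R `*` @I01 R))%E by rewrite II1.
Qed.

Theorem theorem6p6 (R : realType)
  (C : nat -> R -> R -> R -> R) (C0 : R -> R -> R -> R)
  (K : nat -> R.-pker R ~> (R * R)%type) (K0 : R.-pker R ~> (R * R)%type)
  (L : nat -> R.-pker R ~> (R * R)%type) (L0 : R.-pker R ~> (R * R)%type)
  (c13 c23 : R * R -> R) (p13 p23 p123 : R) :
  (forall n, is_copula3 (C n)) -> is_copula3 C0 ->
  (forall n, is_rcd (C n) (K n)) -> is_rcd C0 K0 ->
  (forall n, cond_cont (K n)) -> cond_cont K0 ->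
  abs_cont3 C0 ->
  is_density2 (C13 C0) c13 -> is_density2 (C23 C0) c23 ->
  1 < p13 -> 1 < p23 -> 1 < p123 ->
  (Lp_norm2 p13 c13 < +oo)%E -> (Lp_norm2 p23 c23 < +oo)%E ->
  (Lp_norm3 p123 (fun x => (c13 (x.1.1, x.2) * c23 (x.1.2, x.2))%R) < +oo)%E ->
  (forall n, is_rcd (psi (K n)) (L n)) -> is_rcd (psi K0) L0 ->
  (fun n => D1 (K n) K0) @ \oo --> 0%E ->
  (fun n => D1 (L n) L0) @ \oo --> 0%E.
Proof.
move=> C3 C03 CK C0K Kc K0c _ _ _ _ _ _ _ _ _ LK L0K DK.
have Kcvg e : 0 < e -> \forall n \near \oo,
    forall u1 u2, I01 u1 -> I01 u2 -> (kdist (K n) K0 u1 u2 < e%:E)%E.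
  (* [kdist_small] asks for a tolerance of at most 1. *)
  move=> e0; pose d := Num.min e 1.
  have d01 : 0 < d <= 1 by rewrite lt_min e0 ltr01 ge_min lexx orbT.
  have [d0 _] := andP d01.
  have D0 n : (0 <= D1 (K n) K0)%E by rewrite D1E; apply: integral_ge0 => u _; exact: kdist_ge0.
  have e'0 : 0 < d / 2 * (d / 8 * (d / 8)) by rewrite !mulr_gt0.
  apply: filterS ((proj1 (ge0_cvg0P D0)) DK _ e'0) => n Dn u1 u2 Iu1 Iu2.
  apply: lt_le_trans (kdist_small (C3 n) (CK n) C03 C0K d01 Dn Iu1 Iu2) _.
  by rewrite lee_fin ge_min lexx.
apply/ge0_cvg0P => [n|e e0].
  by rewrite D1E; apply: integral_ge0 => u _; exact: kdist_ge0.
(* Three errors of [e / 4] leave room for the strict inequality. *)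
have e4 : 0 < e / 4 by rewrite divr_gt0.
have PK := lip_unit_square_cvg_unif (fun n => @partial_copula_lip R (K n))
  (@partial_copula_lip R K0)
  (fun s1 s2 e' => @cvg_partial_copula R K K0 C C0 C3 C03 CK C0K Kc K0c Kcvg s1 s2 e') e4.
apply: filterS2 PK (Kcvg _ e4) => n Pn Kn.
apply: (@le_lt_trans _ _ (3 * (e / 4))%:E); last by rewrite lte_fin; lra.
apply: D1_le => [|u1 u2 Iu1 Iu2]; first by rewrite mulr_ge0 // ltW.
by apply: (kdist_psi_le (LK n) L0K _ Pn) => // [|v1 v2 Iv1 Iv2]; [exact: ltW|exact/ltW/Kn].
Qed.
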